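(* Let $E$ be a nontrivial (i.e. $E\neq\{0\}$) Archimedean real vector lattice and let $n\in\mathbb{N}$. Then $$\sum_{k=1}^{n}f_k=\sum_{k=1}^{n}\mathcal{M}_k(f_1,\dots,f_n)$$ holds for all $f_1,\dots,f_n\in E$.
   Context: $\mathbb{N}$ is the set of strictly positive integers and $[n]:=\{1,\dots,n\}$. For $f_1,\dots,f_n\in E$ and $k\in[n]$, $$\mathcal{M}_k(f_1,\dots,f_n)=\bigvee_{\substack{i_1,\dots,i_{n+1-k}\in[n]\\ i_1<i_2<\cdots<i_{n+1-k}}}\ \bigwedge_{j=1}^{n+1-k}f_{i_j}.$$ *)

(* Defs.v *)
From HB Require Import structures.
From mathcomp Require Import all_boot all_order all_algebra.
From mathcomp Require Import reals.

Set Implicit Arguments.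
Unset Strict Implicit.
Unset Printing Implicit Defensive.

Import Order.TTheory GRing.Theory Num.Theory.
Local Open Scope ring_scope.

(* This is a plain record and not a join of [GRing.Lmodule] and [Order.Lattice]*)
(* because the hierarchy already contains totally ordered structures below     *)
(* both and rejects a further common heir. The library lattice structure is    *)
(* derived from the fields below on the carrier of every vector lattice.       *)
Record vectorLattice_axioms (R : numDomainType) (V : lmodType R) := {
  vl_le : rel V;
  vl_meet : V -> V -> V;
  vl_join : V -> V -> V;
  vl_le_refl : reflexive vl_le;
  vl_le_anti : antisymmetric vl_le;
  vl_le_trans : transitive vl_le;
  vl_lexI : forall x y z, vl_le x (vl_meet y z) = vl_le x y && vl_le x z;
  vl_leUx : forall x y z, vl_le (vl_join x y) z = vl_le x z && vl_le y z;
  vl_leD2r : forall z x y : V, vl_le x y -> vl_le (x + z) (y + z);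
  vl_scaler_ge0 : forall (a : R) (x : V),
    0 <= a -> vl_le 0 x -> vl_le 0 (a *: x) }.

Record vectorLatticeType (R : numDomainType) := VectorLattice {
  vl_lmod : lmodType R;
  vl_axioms : vectorLattice_axioms vl_lmod }.

Definition vl_sort (R : numDomainType) (E : vectorLatticeType R) : Type :=
  vl_lmod E.
Coercion vl_sort : vectorLatticeType >-> Sortclass.

HB.instance Definition _ (R : numDomainType) (E : vectorLatticeType R) :=
  GRing.Lmodule.copy (vl_sort E) (vl_lmod E).

HB.instance Definition _ (R : numDomainType) (E : vectorLatticeType R) :=
  Order.Le_isPOrder.Build ring_display (vl_sort E)
    (@vl_le_refl R _ (vl_axioms E)) (@vl_le_anti R _ (vl_axioms E))
    (@vl_le_trans R _ (vl_axioms E)).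

HB.instance Definition _ (R : numDomainType) (E : vectorLatticeType R) :=
  Order.POrder_MeetJoin_isLattice.Build ring_display (vl_sort E)
    (@vl_lexI R _ (vl_axioms E)) (@vl_leUx R _ (vl_axioms E)).

Lemma lerD2r_vl (R : numDomainType) (E : vectorLatticeType R) (z x y : E) :
  x <= y -> x + z <= y + z.
Proof. exact: vl_leD2r. Qed.

Lemma scaler_ge0_vl (R : numDomainType) (E : vectorLatticeType R) (a : R)
    (x : E) : 0 <= a -> 0 <= x -> 0 <= a *: x.
Proof. exact: vl_scaler_ge0. Qed.

Definition archimedean (R : numDomainType) (E : vectorLatticeType R) : Prop :=
  forall u v : E, 0 <= u -> 0 <= v -> (forall n : nat, v *+ n <= u) -> v = 0.

Definition nontrivial (R : numDomainType) (E : vectorLatticeType R) : Prop :=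
  exists x : E, x != 0.

(* A vector lattice has no bottom or top element in general, so the iterated   *)
(* operators \join and \meet of the order library do not apply. Finite joins   *)
(* and meets are computed in [option E], with neutral element [None]; the      *)
(* default value 0 is only reached on an empty family.                         *)
Definition fjoin (R : numDomainType) (E : vectorLatticeType R) (I : finType)
    (P : pred I) (F : I -> E) : E :=
  odflt 0 (\big[oAC (@joinA _ E) (@joinC _ E)/None]_(i | P i) Some (F i)).

Definition fmeet (R : numDomainType) (E : vectorLatticeType R) (I : finType)
    (P : pred I) (F : I -> E) : E :=
  odflt 0 (\big[oAC (@meetA _ E) (@meetC _ E)/None]_(i | P i) Some (F i)).

Lemma odflt_big_oACP (T : Type) (op : T -> T -> T) (opA : associative op)
    (opC : commutative op) (p : pred T) (I : finType) (P : pred I)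
    (F : I -> T) (x0 : T) (i0 : I) :
  (forall x y, p (op x y) = p x && p y) -> P i0 ->
  reflect (forall i, P i -> p (F i))
          (p (odflt x0 (\big[oAC opA opC/None]_(i | P i) Some (F i)))).
Proof.
move=> pM Pi0.
have pbig (r : seq I) :
    oapp p true (\big[oAC opA opC/None]_(i <- r | P i) Some (F i))
    = all (fun i => P i ==> p (F i)) r.
  elim: r => [|i r IHr]; first by rewrite big_nil.
  rewrite big_cons /=; case: (P i) => //=; rewrite -IHr.
  by case: (bigop _ _ _) => [z|]; rewrite /oAC /= ?pM ?andbT.
have -> : p (odflt x0 (\big[oAC opA opC/None]_(i | P i) Some (F i)))
        = oapp p true (\big[oAC opA opC/None]_(i | P i) Some (F i)).
  by rewrite (bigD1 i0) //=; case: (bigop _ _ _).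
rewrite pbig; apply: (iffP allP) => pF i; last by move=> _; apply/implyP/pF.
by move: (pF i (mem_index_enum i)) => /implyP.
Qed.

Lemma fjoin_leP (R : numDomainType) (E : vectorLatticeType R) (I : finType)
    (P : pred I) (F : I -> E) (i0 : I) (y : E) :
  P i0 -> reflect (forall i, P i -> F i <= y) (fjoin P F <= y).
Proof.
by apply: (@odflt_big_oACP E _ _ _ (fun x => x <= y)) => u v; exact: leUx.
Qed.

Lemma fmeet_geP (R : numDomainType) (E : vectorLatticeType R) (I : finType)
    (P : pred I) (F : I -> E) (i0 : I) (y : E) :
  P i0 -> reflect (forall i, P i -> y <= F i) (y <= fmeet P F).
Proof.
by apply: (@odflt_big_oACP E _ _ _ (fun x => y <= x)) => u v; exact: lexI.
Qed.

(* The tuples [t] range over i_1 < ... < i_(n+1-k), with indices in            *)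
(* {0, ..., n-1}. This is meaningful for 1 <= k <= n.                          *)
Definition calM (R : numDomainType) (E : vectorLatticeType R) (n k : nat)
    (f : 'I_n -> E) : E :=
  fjoin (fun t : (n.+1 - k).-tuple 'I_n =>
           sorted (fun i j : 'I_n => (i < j)%N) t)
        (fun t => fmeet xpredT (fun j => f (tnth t j))).

(* Main.v *)
(** The order statistics [S_j] (join over [j]-subsets of the meets) obey
    [S_j (x, s) = S_j s \/ (x /\ S_(j-1) s)], by distributivity of the lattice.
    As [S_j <= S_(j-1)] and [a \/ b = a + b - a /\ b], the right-hand side is
    [S_j s + x /\ S_(j-1) s - x /\ S_j s]; summed over [j] this telescopes to
    [\sum_j S_j s + x]. *)
Require Import Defs.
From HB Require Import structures.
From mathcomp Require Import all_boot all_order all_algebra.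
From mathcomp Require Import reals.

Import Order.LTheory GRing.Theory Num.Theory.
Local Open Scope ring_scope.

Section VectorLattice.
Set Implicit Arguments.
Unset Strict Implicit.
Variables (R : numDomainType) (E : vectorLatticeType R).
Implicit Types (x y z w a b lo hi : E).

Lemma lerD2r_vlE z x y : (x + z <= y + z) = (x <= y).
Proof.
apply/idP/idP => [|h]; last exact: lerD2r_vl.
by move=> /(@lerD2r_vl _ _ (- z)); rewrite !addrK.
Qed.

Lemma lerBlDr_vl x y z : (x - y <= z) = (x <= z + y).
Proof. by rewrite -(lerD2r_vlE y (x - y)) subrK. Qed.

Lemma lerBrDr_vl x y z : (x <= y - z) = (x + z <= y).
Proof. by rewrite -(lerD2r_vlE z x) subrK. Qed.

(** From [x /\ y <= y] follows [x <= x + y - x /\ y], and likewise for [y]. Conversely,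
    [x + y - x \/ y] lies below both [x] and [y]. *)
Lemma join_vlE x y : Order.join x y = x + y - Order.meet x y.
Proof.
have leD2l c a b : (c + a <= c + b) = (a <= b).
  by rewrite ![c + _]addrC lerD2r_vlE.
apply: le_anti; apply/andP; split.
  rewrite leUx !lerBrDr_vl leD2l leIr /=.
  by rewrite [y + _]addrC lerD2r_vlE leIl.
rewrite lerBlDr_vl [X in _ <= X]addrC -lerBlDr_vl lexI.
rewrite !lerBlDr_vl leD2l leUr /=.
by rewrite [x + y]addrC leD2l leUl.
Qed.

(** The nontrivial half of distributivity. In [z /\ d = d - (z \/ d - z)] the subtracted term grows
    with [d], so [a] and [b], hence also their join [c], lie below [w + (z \/ c - z)]. *)
Lemma meet_joinr_le_vl z a b :
  Order.meet z (Order.join a b)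
    <= Order.join (Order.meet z a) (Order.meet z b).
Proof.
set w := Order.join (Order.meet z a) _; set c := Order.join a b.
have meet_vlE d : Order.meet z d = d - (Order.join z d - z).
  by rewrite join_vlE [z + d]addrC addrAC addrK opprB addrC subrK.
have bound d : d <= c -> Order.meet z d <= w -> d <= w + (Order.join z c - z).
  rewrite meet_vlE lerBlDr_vl => dc /le_trans; apply.
  rewrite ![w + _]addrC !lerD2r_vlE.
  by rewrite leUx leUl lexU2 ?dc ?orbT.
rewrite meet_vlE lerBlDr_vl leUx.
by rewrite !bound ?leUl ?leUr.
Qed.

Section OrderStatistics.
Variables (I : eqType) (f : I -> E) (lo hi : E).
Hypotheses (lo_le : forall i, lo <= f i) (le_hi : forall i, f i <= hi).
Implicit Types (s u : seq I) (j : nat).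

(* The [j]-th largest of the values of [f] along [s], counted from [1]; the
   bounds [hi] and [lo] stand for the missing values at [0] and beyond
   [size s]. *)
Fixpoint ordstat j s : E :=
  match j, s with
  | 0, _ => hi
  | _.+1, [::] => lo
  | j'.+1, i :: s' =>
      Order.join (ordstat j s') (Order.meet (f i) (ordstat j' s'))
  end.

Hypothesis lo_hi : lo <= hi.

Lemma ordstat_le j s : ordstat j s <= hi.
Proof.
elim: s j => [|i s IHs] [|j] //=.
by rewrite leUx IHs leIx2 // le_hi.
Qed.

Lemma ordstat_decr j s : ordstat j.+1 s <= ordstat j s.
Proof.
elim: s j => [|i s IHs] [|j] //; first exact: ordstat_le.
rewrite [ordstat _ _]/= [X in _ <= X]/= leUx.
by rewrite lexU2 ?IHs //= lexU2 // leI2 ?IHs ?orbT.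
Qed.

Lemma ordstat_oversize j s : (size s < j)%N -> ordstat j s = lo.
Proof.
elim: s j => [|i s IHs] [|j] //= sj; rewrite !IHs ?(ltnW sj) //.
by rewrite (meet_r (lo_le i)) joinxx.
Qed.

Lemma sum_ordstat s : \sum_(0 <= j < size s) ordstat j.+1 s = \sum_(i <- s) f i.
Proof.
elim: s => [|i s IHs]; first by rewrite big_geq ?big_nil.
have step j : ordstat j.+1 (i :: s) = ordstat j.+1 s
    - (Order.meet (f i) (ordstat j.+1 s) - Order.meet (f i) (ordstat j s)).
  rewrite /= join_vlE meetCA (meet_l (ordstat_decr _ _)).
  by rewrite opprB addrA.
rewrite (eq_bigr _ (fun j _ => step j)) /= sumrB telescope_sumr //.
(* The extra summand [j = size s] and the upper end of the telescope both equal [lo] and cancel; the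
   lower end is [f i /\ hi = f i]. *)
rewrite big_nat_recr //= IHs ordstat_oversize // big_cons.
have -> : ordstat 0 s = hi by case: (s).
rewrite (meet_r (lo_le i)) (meet_l (le_hi i)).
by rewrite opprB addrA addrAC addrK addrC.
Qed.

(** Together with [meet_ordstat_upper], this identifies [ordstat j s] as a join of meets over
    subsequences of length [j]. The bound [w <= hi] covers empty [u]. *)
Lemma ordstat_lower w s u : w <= hi -> subseq u s ->
  {in u, forall i, w <= f i} -> w <= ordstat (size u) s.
Proof.
move=> w_hi; elim: s u => [|i s IHs] [|k u] //.
rewrite [subseq _ _]/=; case: eqP => [->|_] us wu; rewrite lexU2 //=.
  rewrite lexI wu ?mem_head // IHs ?orbT // => l lu.
  by rewrite wu // inE lu orbT.
by rewrite (IHs (k :: u)).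
Qed.

(** The meet with [z] makes the induction work: after distributing, a selected head [f i] is
    absorbed into [z]. *)
Lemma meet_ordstat_upper j s y z : lo <= y ->
  (forall u w, subseq u s -> size u = j -> w <= z -> w <= hi ->
    {in u, forall i, w <= f i} -> w <= y) ->
  Order.meet z (ordstat j s) <= y.
Proof.
move=> lo_y; elim: s j z => [|i s IHs] [|j] z y_ub.
- by apply: (y_ub [::]); rewrite ?leIl ?leIr.
- by rewrite leIx2 // lo_y orbT.
- by apply: (y_ub [::]); rewrite ?leIl ?leIr.
apply: le_trans (meet_joinr_le_vl _ _ _) _; rewrite leUx.
apply/andP; split.
  apply: IHs => u w us; apply: y_ub.
  exact: subseq_trans us (subseq_cons _ _).
rewrite meetA; apply: IHs => u w us uj; rewrite lexI.
move=> /andP[wz wi] w_hi wu; apply: (y_ub (i :: u)) => //=.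
- by rewrite eqxx.
- by rewrite uj.
by move=> k; rewrite inE => /predU1P[->|/wu].
Qed.

End OrderStatistics.

(** A list sorted by a strict order is determined by its members, so an increasing [t] is the
    enumeration filtered by membership in [t]. *)
Lemma sorted_ord_subseq n (t : seq 'I_n) :
  sorted (fun i j : 'I_n => (i < j)%N) t = subseq t (enum 'I_n).
Proof.
have lt_trans : transitive (fun i j : 'I_n => (i < j)%N).
  by move=> i j k; exact: ltn_trans.
have lt_irr : irreflexive (fun i j : 'I_n => (i < j)%N).
  by move=> i; exact: ltnn.
have enum_sorted : sorted (fun i j : 'I_n => (i < j)%N) (enum 'I_n).
  rewrite -(@sorted_map _ _ (@nat_of_ord n) ltn) val_enum_ord.
  exact: iota_ltn_sorted.
apply/idP/idP => [t_sorted|]; last by move/subseq_sorted; apply.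
have -> : t = [seq i <- enum 'I_n | i \in t]; last exact: filter_subseq.
apply: (irr_sorted_eq lt_trans lt_irr) => //; first exact: sorted_filter.
by move=> i; rewrite mem_filter mem_enum andbT.
Qed.

Lemma calM_ordstat n k (f : 'I_n -> E) lo hi :
  (forall i, lo <= f i) -> (forall i, f i <= hi) -> (0 < k <= n)%N ->
  calM k f = ordstat f lo hi (n.+1 - k) (enum 'I_n).
Proof.
move=> lo_le le_hi /andP[k_gt0 k_le].
have n_gt0 : (0 < n)%N by exact: leq_trans k_le.
have lo_hi : lo <= hi by exact: le_trans (le_hi (Ordinal n_gt0)).
(* The default 0 of [fmeet] and [fjoin] is never reached: [k <= n] provides the index [j0], and
   [0 < k] leaves enough indices for an initial tuple. *)
have j_gt0 : (0 < n.+1 - k)%N by rewrite subn_gt0.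
pose j0 := Ordinal j_gt0.
have t0P : size (take (n.+1 - k) (enum 'I_n)) == (n.+1 - k)%N.
  by rewrite size_takel // size_enum_ord leq_subLR -addn1 addnC leq_add2r.
have t0_sorted : sorted (fun i j : 'I_n => (i < j)%N) (Tuple t0P).
  by rewrite sorted_ord_subseq take_subseq.
have le_calM (t : (n.+1 - k).-tuple 'I_n) w :
    sorted (fun i j : 'I_n => (i < j)%N) t ->
    {in t, forall i, w <= f i} -> w <= calM k f.
  move=> t_sorted wt.
  have /(fjoin_leP _ _ t0_sorted)/(_ _ t_sorted) := le_refl (calM k f).
  apply: le_trans; apply/(fmeet_geP _ _ (i0 := j0)) => // j _.
  by rewrite wt ?mem_tnth.
apply: le_anti; apply/andP; split.
  apply/(fjoin_leP _ _ t0_sorted) => t t_sorted.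
  set w := fmeet _ _.
  have wt i : i \in val t -> w <= f i.
    move=> /tnthP[j ->]; have := le_refl w.
    by move=> /(fmeet_geP _ _ (i0 := j0) isT)/(_ j isT).
  rewrite -[(n.+1 - k)%N](size_tuple t).
  apply: ordstat_lower => //; last by rewrite -sorted_ord_subseq.
  by rewrite (le_trans (wt _ (mem_tnth j0 t))).
(* Introduces the meet required by [meet_ordstat_upper], with [z = hi]. *)
rewrite -(meet_r (ordstat_le le_hi lo_hi (n.+1 - k) (enum 'I_n))).
apply: meet_ordstat_upper => [|u w us /eqP uj _ _ wu].
  exact: (le_calM _ _ t0_sorted).
by apply: (le_calM (Tuple uj)); rewrite ?sorted_ord_subseq.
Qed.

End VectorLattice.

Theorem corollary3p6 (R : realType) (E : vectorLatticeType R)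
    (E_arch : archimedean E) (E_nontrivial : nontrivial E)
    (n : nat) (n_gt0 : (0 < n)%N) (f : 'I_n -> E) :
  \sum_(i < n) f i = \sum_(1 <= k < n.+1) calM k f.
Proof.
pose i0 := Ordinal n_gt0.
(* These stand in for the bottom and top that [E] need not have. *)
pose lo := fmeet xpredT f; pose hi := fjoin xpredT f.
have lo_le i : lo <= f i.
  by move: i (isT); apply/(fmeet_geP _ _ (i0 := i0)).
have le_hi i : f i <= hi.
  by move: i (isT); apply/(fjoin_leP _ _ (i0 := i0)).
have lo_hi : lo <= hi by exact: le_trans (le_hi i0).
rewrite -big_enum -(sum_ordstat lo_le le_hi lo_hi) size_enum_ord.
(* [calM k] is the [k]-th smallest value, while [ordstat] counts from the largest; hence the
   reversal. *)
rewrite big_nat_rev big_add1 /=.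
apply: eq_big_nat => j /andP[_ jn].
rewrite (calM_ordstat lo_le le_hi) ?jn // add0n subSS.
by rewrite subnSK.
Qed.
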